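(* For every integer $n\ge 1$, the operator $\bar{\mathbb{B}}_n : C[0,1]\to C[0,1]$ is injective.
   Context: $C[0,1]$ is the space of real-valued continuous functions on $[0,1]$. The genuine Beta operator $\bar{\mathbb{B}}_n:C[0,1]\to C[0,1]$ is defined for $f\in C[0,1]$ by $\bar{\mathbb{B}}_n(f;0)=f(0)$, $\bar{\mathbb{B}}_n(f;1)=f(1)$, and for $x\in(0,1)$ $$\bar{\mathbb{B}}_n(f;x)=\frac{1}{B(nx,n(1-x))}\int_0^1 t^{nx-1}(1-t)^{n(1-x)-1}f(t)\,dt,$$ where $B(\cdot,\cdot)$ is the Euler Beta function. *)

(* Defs.v *)
From HB Require Import structures.
From mathcomp Require Import all_boot all_order all_algebra.
From mathcomp Require Import all_classical all_reals all_analysis.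
Import Order.TTheory GRing.Theory Num.Theory.
Import numFieldNormedType.Exports.

Set Implicit Arguments.
Unset Strict Implicit.
Unset Printing Implicit Defensive.

Local Open Scope classical_set_scope.
Local Open Scope ring_scope.

(* An element of C[0,1] is represented by a total function f : R -> R with
   {within `[0, 1], continuous f}; two such functions denote the same element
   when they agree on `[0, 1]. *)

(* The library's beta_fun only takes natural number parameters.  The integrals
   are over the open interval, as the powers may be singular at 0 and 1. *)
Definition euler_beta (R : realType) (a b : R) : R :=
  \int[@lebesgue_measure R]_(t in `]0, 1[)
    (t `^ (a - 1) * (1 - t) `^ (b - 1)).

(* Only the values at x in `[0, 1] are meaningful. *)
Definition genuine_beta (R : realType) (n : nat) (f : R -> R) (x : R) : R :=
  if x == 0 then f 0
  else if x == 1 then f 1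
  else (euler_beta (n%:R * x) (n%:R * (1 - x)))^-1 *
       \int[@lebesgue_measure R]_(t in `]0, 1[)
         (t `^ (n%:R * x - 1) * (1 - t) `^ (n%:R * (1 - x) - 1) * f t).

(* Main.v *)
(* Put h = f - g, u(t) = ln t - ln (1 - t) and psi(t) = (t (1 - t))^(n/2 - 1) h(t).
   At x = 1/2 + s/n the hypothesis says that the integral of e^(s u) psi over
   ]0, 1[ vanishes, for |s| <= n/4, while e^(n/4 |u|) psi is integrable.
   Letting s tend to 0, the integrals of u^k psi vanish for all k; expanding
   cos around a frequency l with increments at most n/16, the vanishing of the
   integrals of u^k cos (l u + th) psi propagates to all l.  Products of
   cosines are sums of cosines, so cos (s (u - u0) / m)^(m^2) integrates to 0
   against psi, and in the limit so does the Gaussian e^(- s^2 (u - u0)^2 / 2).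
   Large s concentrates it at u0, which forces psi = 0. *)
Require Import Defs.
From HB Require Import structures.
From mathcomp Require Import all_boot all_order all_algebra.
From mathcomp Require Import all_classical all_reals all_analysis.
From mathcomp Require Import measurable_realfun.
From mathcomp Require Import ring lra.
Import Order.TTheory GRing.Theory Num.Theory.
Import numFieldNormedType.Exports.
Local Open Scope classical_set_scope.
Local Open Scope ring_scope.

Set Implicit Arguments.
Unset Strict Implicit.
Unset Printing Implicit Defensive.

(** * Taylor bounds for cos and exp *)

Section Taylor.
Context {R : realType}.
Implicit Types (c : nat -> R -> R) (x y : R).

(** The mean value theorem is applied to [P - D] and [P + D], whose derivatives are nonnegative on
    [0, X]. *)
Lemma derivative_bound (D D' P P' : R -> R) (X : R) :
  (forall y, is_derive y 1 D (D' y)) -> (forall y, is_derive y 1 P (P' y)) ->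
  D 0 = 0 -> P 0 = 0 -> (forall y, 0 <= y <= X -> `|D' y| <= P' y) ->
  forall x, 0 <= x <= X -> `|D x| <= P x.
Proof.
move=> dD dP D0 P0 DP.
suff main (s : R) : (s = 1 \/ s = -1) -> forall x, 0 <= x <= X -> s * D x <= P x.
  move=> x xX; have := main 1 (or_introl erefl) x xX.
  have := main (-1) (or_intror erefl) x xX.
  by rewrite ler_norml; lra.
move=> hs x /andP[x0 xX].
pose E := fun y => P y - s * D y.
have dE y : is_derive y 1 E (P' y - s * D' y).
  by have ? := dD y; have ? := dP y; exact: (@is_deriveB _ _ _ P (s \*: D)).
have [->|xn0] := eqVneq x 0; first by rewrite D0 P0 mulr0.
have [z /[!in_itv]/= /andP[z0 zx]] : exists2 z, z \in `]0, x[ &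
    E x - E 0 = (P' z - s * D' z) * (x - 0).
  apply: MVT => //; first by rewrite lt_neqAle eq_sym xn0.
  apply: continuous_subspaceT => y; apply/differentiable_continuous.
  by apply/derivable1_diffP; have [] := dE y.
rewrite /E D0 P0 mulr0 !subr0 => Exz; rewrite -subr_ge0 Exz mulr_ge0// subr_ge0.
have /DP : 0 <= z <= X by rewrite (ltW z0) (le_trans (ltW zx)).
rewrite ler_norml => /andP[]; case: hs => ->; lra.
Qed.

Lemma is_derive_exp_fact k y :
  is_derive y 1 (fun z => z ^+ k.+1 / k.+1`!%:R : R) (y ^+ k / k`!%:R).
Proof.
rewrite (_ : (fun _ => _) = k.+1`!%:R^-1 \*: (@id R) ^+ k.+1); last first.
  by apply/funext => z; rewrite !fctE mulrC.
apply: is_derive_eq; rewrite /= /GRing.scale /= factS natrM.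
have f0 : (k`!%:R : R) != 0 by rewrite pnatr_eq0 -lt0n fact_gt0.
by rewrite mulr1; field; rewrite f0 nat1r pnatr_eq0.
Qed.

(** In use, [c j] is the j-th derivative of [c 0], so this is its Taylor polynomial at 0, with terms
    of degree below [N]. *)
Definition taylor_sum c N x := \sum_(j < N) x ^+ j / j`!%:R * c j 0.

Lemma taylor_sum0 c N : taylor_sum c N.+1 0 = c 0%N 0.
Proof.
rewrite /taylor_sum big_ord_recl big1 => [|i _].
  by rewrite addr0 expr0 fact0 divr1 mul1r.
by rewrite exprS !mul0r.
Qed.

Lemma is_derive_taylor_sum c N x :
  is_derive x 1 (taylor_sum c N.+1) (taylor_sum (fun j => c j.+1) N x).
Proof.
elim: N => [|N IH].
  rewrite /taylor_sum big_ord0 (_ : (fun _ => _) = cst (c 0%N 0)).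
    exact: is_derive_cst.
  by apply/funext => z; rewrite big_ord1 expr0 fact0 divr1 mul1r.
rewrite [X in is_derive _ _ X](_ : _ = taylor_sum c N.+1 +
    c N.+1 0 \*: (fun z => z ^+ N.+1 / N.+1`!%:R : R)); last first.
  apply/funext => z; rewrite !fctE /taylor_sum big_ord_recr /=.
  by congr (_ + _); exact: mulrC.
have -> : taylor_sum (fun j => c j.+1) N.+1 x =
    taylor_sum (fun j => c j.+1) N x + c N.+1 0 *: (x ^+ N / N`!%:R).
  by rewrite {1}/taylor_sum big_ord_recr /=; congr (_ + _); exact: mulrC.
by have ? := is_derive_exp_fact N x; exact: is_deriveD.
Qed.

(** Differentiating the remainder at order N + 1 gives the remainder at order N of the shifted
    sequence, so the induction runs over all [c] at once and [derivative_bound] integrates the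
    estimate. *)
Lemma taylor_bound_ge0 (M X : R) (N : nat) c :
  (forall j y, is_derive y 1 (c j) (c j.+1 y)) ->
  (forall j y, 0 <= y <= X -> `|c j y| <= M) ->
  forall x, 0 <= x <= X -> `|c 0%N x - taylor_sum c N x| <= M * (x ^+ N / N`!%:R).
Proof.
elim: N c => [|N IH] c dc bc.
  by move=> x xX; rewrite /taylor_sum big_ord0 subr0 expr0 fact0 divr1 mulr1 bc.
apply: (@derivative_bound _
  (fun y => c 1%N y - taylor_sum (fun j => c j.+1) N y) _
  (fun y => M * (y ^+ N / N`!%:R))).
- by move=> y; have ? := is_derive_taylor_sum c N y; exact: is_deriveB.
- move=> y; have ? := is_derive_exp_fact N y.
  rewrite (_ : (fun _ => _) = M \*: (fun z => z ^+ N.+1 / N.+1`!%:R : R))//.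
  exact: is_derive_eq.
- by rewrite taylor_sum0 subrr.
- by rewrite exprS !mul0r mulr0.
- exact: (IH (fun j => c j.+1) (fun j => dc j.+1) (fun j => bc j.+1)).
Qed.

Lemma taylor_bound (M : R) (N : nat) c x :
  (forall j y, is_derive y 1 (c j) (c j.+1 y)) ->
  (forall j y, `|y| <= `|x| -> `|c j y| <= M) ->
  `|c 0%N x - taylor_sum c N x| <= M * (`|x| ^+ N / N`!%:R).
Proof.
move=> dc bc; have [x0|x0] := leP 0 x.
  rewrite (ger0_norm x0); apply: (@taylor_bound_ge0 M x) => //; last by rewrite x0/=.
  by move=> j y /andP[y0 yx]; apply: bc; rewrite !ger0_norm.
(* For negative x the function is reflected: [d] lists the derivatives of y |-> c 0 (- y), with the
   signs of the chain rule. *)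
pose d j y := (-1) ^+ j * c j (- y).
have -> : c 0%N x = d 0%N (- x) by rewrite /d mul1r opprK.
have -> : taylor_sum c N x = taylor_sum d N (- x).
  apply: eq_bigr => j _; rewrite /d oppr0 (exprNn x).
  have : (-1) ^+ j * (-1) ^+ j = 1 :> R by rewrite -exprMn mulrNN mulr1 expr1n.
  by set e := (-1) ^+ j => ee; rewrite -[in LHS](mulr1 (x ^+ j)) -ee; ring.
rewrite (ltr0_norm x0); apply: (@taylor_bound_ge0 M (- x)) => //.
- move=> j y; have ? := dc j (- y).
  rewrite (_ : d j = (-1) ^+ j \*: (c j \o -%R)); last exact/funext.
  apply: is_derive_eq; rewrite /d /GRing.scale /= exprS; ring.
- move=> j y /andP[y0 yx]; rewrite normrM normrX normrN1 expr1n mul1r bc//.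
  by rewrite normrN (ltr0_norm x0) ger0_norm.
- by rewrite lexx oppr_ge0 ltW.
Qed.

(** Each differentiation of cos advances the phase by pi / 2, which writes all derivatives by one
    formula. *)
Lemma is_derive_cos_shift (y : R) (j : nat) x :
  is_derive x 1 (fun x => cos (y + x + j%:R * (pi / 2)))
    (cos (y + x + j.+1%:R * (pi / 2))).
Proof.
rewrite (_ : (fun _ => _) = cos \o (cst (y + j%:R * (pi / 2)) + id)); last first.
  by apply/funext => z; rewrite /= addrAC.
apply: is_derive_eq.
rewrite /= /GRing.scale /= add0r mulr1 fctE /=.
rewrite -cosDpihalf -(natr1 j); congr cos; lra.
Qed.

Lemma cos_taylor (y x : R) N :
  `|cos (y + x) - \sum_(j < N) x ^+ j / j`!%:R * cos (y + j%:R * (pi / 2))|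
  <= `|x| ^+ N / N`!%:R.
Proof.
have := @taylor_bound 1 N (fun j z => cos (y + z + j%:R * (pi / 2))) x
  (is_derive_cos_shift y) (fun j z _ => cos_max _).
rewrite /taylor_sum /= mul1r mul0r addr0.
by under eq_bigr do rewrite addr0.
Qed.

Lemma expR_taylor (x : R) N :
  `|expR x - \sum_(j < N) x ^+ j / j`!%:R| <= expR `|x| * (`|x| ^+ N / N`!%:R).
Proof.
have := @taylor_bound (expR `|x|) N (fun=> expR) x (fun=> @is_derive_expR R).
rewrite /taylor_sum; under eq_bigr do rewrite expR0 mulr1.
apply => _ y yx; rewrite ger0_norm ?expR_ge0// ler_expR.
exact: le_trans (ler_norm _) yx.
Qed.

(** A single term (a |x|)^k / k! of the exponential series is at most its sum. This absorbs powers
    into the exponential weight. *)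
Lemma exprn_le_expR (a x : R) k : 0 < a ->
  `|x| ^+ k <= k`!%:R / a ^+ k * expR (a * `|x|).
Proof.
move=> a0; rewrite mulrAC ler_pdivlMr ?exprn_gt0// -exprMn [leRHS]mulrC.
rewrite -ler_pdivrMr ?ltr0n ?fact_gt0// (mulrC `|x|).
have ax : 0 <= a * `|x| by rewrite mulr_ge0// ltW.
case: k => [|k]; first by rewrite expr0 fact0 divr1 -expR0 ler_expR.
by apply: le_trans (expR_ge1Dxn k ax); rewrite lerDr.
Qed.

End Taylor.

(** Telescoping: the factors [a] are replaced by [b] one at a time, each at cost |a - b|, the other
    factors being at most 1 in absolute value. *)
Lemma normr_subX_le {R : realFieldType} (a b : R) k : `|a| <= 1 -> `|b| <= 1 ->
  `|a ^+ k - b ^+ k| <= k%:R * `|a - b|.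
Proof.
move=> a1 b1; elim: k => [|k IH]; first by rewrite !expr0 subrr normr0 mul0r.
have -> : a ^+ k.+1 - b ^+ k.+1 = a * (a ^+ k - b ^+ k) + (a - b) * b ^+ k.
  by rewrite !exprS; ring.
apply: le_trans (ler_normD _ _) _; rewrite !normrM -natr1 mulrDl mul1r lerD//.
  by rewrite -[leRHS]mul1r ler_pM.
by rewrite ler_piMr// normrX exprn_ile1.
Qed.

(** From 1 - z <= e^(- z) <= 1 / (1 + z) and (z^2 + 1 - z)(1 + z) = 1 + z^3. *)
Lemma expRN_quadratic_bound {R : realType} (z : R) : 0 <= z ->
  `|expR (- z) - (1 - z)| <= z ^+ 2.
Proof.
move=> z0; have h1 : 1 - z <= expR (- z) := expR_ge1Dx (- z).
rewrite ger0_norm ?subr_ge0// lerBlDr expRN.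
have h2 : 1 + z <= expR z := expR_ge1Dx z.
have z1 : 0 < 1 + z by rewrite ltr_pwDl.
apply: (@le_trans _ _ (1 + z)^-1); first by rewrite lef_pV2 ?posrE ?expR_gt0.
rewrite -[leLHS]mul1r ler_pdivrMr// -subr_ge0.
have -> : (z ^+ 2 + (1 - z)) * (1 + z) - 1 = z ^+ 3 by ring.
exact: exprn_ge0.
Qed.

(** Both functions are compared with 1 - y^2 / 2: the cosine is within |y|^3 by Taylor, the
    exponential within (y^2 / 2)^2. *)
Lemma cos_expR_bound {R : realType} (y : R) :
  `|cos y - expR (- (y ^+ 2 / 2))| <= `|y| ^+ 3 + `|y| ^+ 4.
Proof.
have := cos_taylor 0 y 3.
rewrite !big_ord_recr big_ord0 /= !add0r.
rewrite mul0r cos0 !mul1r cos_pihalf.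
have -> : 2%:R * (pi / 2) = pi :> R by rewrite mulrC divfK.
rewrite cospi fact0 invr1 mulr1 mulr0 addr0 mulrN1 => hc.
have := @expRN_quadratic_bound R (y ^+ 2 / 2); rewrite divr_ge0 ?sqr_ge0// => /(_ isT) he.
have -> : cos y - expR (- (y ^+ 2 / 2)) = (cos y - (1 - y ^+ 2 / 2))
   - (expR (- (y ^+ 2 / 2)) - (1 - y ^+ 2 / 2)) by ring.
apply: le_trans (ler_normB _ _) _; apply: lerD.
  by apply: le_trans hc _; rewrite ler_piMr// invf_le1// ler1n.
apply: le_trans he _; rewrite -normrX ger0_norm ?exprn_even_ge0//.
have := sqr_ge0 (y ^+ 2); rewrite -exprM; set t := y ^+ 4.
have -> : (y ^+ 2 / 2) ^+ 2 = t / 4 by rewrite /t; field.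
by rewrite -/t; lra.
Qed.

(** * Closure properties of continuous real functions *)

Section ContinuousFunctions.
Context {R : realType}.
Implicit Types F G : R -> R.

Lemma continuous_fun_mul F G : continuous F -> continuous G ->
  continuous (fun v => F v * G v).
Proof. by move=> cF cG v; exact: cvgM (cF v) (cG v). Qed.

Lemma continuous_fun_add F G : continuous F -> continuous G ->
  continuous (fun v => F v + G v).
Proof. by move=> cF cG v; exact: cvgD (cF v) (cG v). Qed.

Lemma continuous_fun_cst (a : R) : continuous (fun _ : R => a).
Proof. by move=> v; exact: cvg_cst. Qed.

Lemma continuous_fun_exp F k : continuous F -> continuous (fun v => F v ^+ k).
Proof.
move=> cF; elim: k => [|k IH].
  by rewrite (_ : (fun _ => _) = cst 1); [exact: continuous_fun_cst|apply/funext].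
by under [fun v => _]funext do rewrite exprS; exact: continuous_fun_mul.
Qed.

Lemma continuous_fun_comp F G : continuous F -> continuous G ->
  continuous (fun v => F (G v)).
Proof. by move=> cF cG v; apply: (continuous_comp (cG v)); exact: cF. Qed.

Lemma continuous_affine (a b : R) : continuous (fun v : R => a * v + b).
Proof.
apply: continuous_fun_add; last exact: continuous_fun_cst.
by apply: continuous_fun_mul; [exact: continuous_fun_cst|move=> v; exact: cvg_id].
Qed.

End ContinuousFunctions.

(** * Linear functionals on functions of exponential growth *)

(* I F stands for the integral of F(u(t)) psi(t); only linearity, a bound and
   the vanishing on small exponentials are used. *)
Section ExpFunctional.
Context {R : realType} (rho M : R) (I : (R -> R) -> R).
Implicit Types (F G : R -> R) (C : R).

(** [C] bounds the sup norm of [F] weighted by e^(- rho |v|), the norm in which the limits below are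
    taken. *)
Definition dominated C F :=
  continuous F /\ forall v, `|F v| <= C * expR (rho * `|v|).

Definition admissible F := exists C, dominated C F.

Context (rho_gt0 : 0 < rho)
  (I_linear : forall a F G, admissible F -> admissible G ->
     I (fun v => a * F v + G v) = a * I F + I G)
  (I_bound : forall C F, dominated C F -> `|I F| <= C * M)
  (I_expR : forall s, `|s| <= rho -> I (fun v => expR (s * v)) = 0).

Let weight_ge1 (v : R) : 1 <= expR (rho * `|v|).
Proof. by rewrite -expR0 ler_expR mulr_ge0// ltW. Qed.

Lemma dominated_bounded C F : continuous F -> (forall v, `|F v| <= C) ->
  dominated C F.
Proof.
move=> cF bF; split=> // v; apply: le_trans (bF v) _.
by rewrite ler_peMr ?weight_ge1// (le_trans _ (bF v))//.
Qed.

Lemma admissible_linear a F G : admissible F -> admissible G ->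
  admissible (fun v => a * F v + G v).
Proof.
move=> [C [cF bF]] [D [cG bG]]; exists (`|a| * C + D); split=> [|v].
  apply: continuous_fun_add => //; apply: continuous_fun_mul => //.
  exact: continuous_fun_cst.
apply: le_trans (ler_normD _ _) _.
by rewrite mulrDl -mulrA lerD// normrM ler_wpM2l.
Qed.

Lemma functional0 : admissible (fun=> 0) /\ I (fun=> 0) = 0.
Proof.
have d0 : dominated 0 (fun=> 0).
  by apply: dominated_bounded => [|v]; [exact: continuous_fun_cst|rewrite normr0].
split; first by exists 0.
by have := I_bound d0; rewrite mul0r normr_le0 => /eqP.
Qed.

Lemma functional_comb n (a : nat -> R) (F : nat -> R -> R) :
  (forall i, (i < n)%N -> admissible (F i) /\ I (F i) = 0) ->
  admissible (fun v => \sum_(i < n) a i * F i v) /\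
  I (fun v => \sum_(i < n) a i * F i v) = 0.
Proof.
elim: n => [_|n IH hF].
  rewrite (_ : (fun _ => _) = (fun=> 0)); first exact: functional0.
  by apply/funext => v; rewrite big_ord0.
rewrite (_ : (fun _ => _) = fun v => a n * F n v + \sum_(i < n) a i * F i v); last first.
  by apply/funext => v; rewrite big_ord_recr addrC.
have [aF F0] := hF n (ltnSn n).
have [aS S0] := IH (fun i hi => hF i (ltnW hi)).
split; first exact: admissible_linear.
by rewrite I_linear// F0 S0 mulr0 addr0.
Qed.

(** By [I_bound], [I] is continuous for the weighted norm, so its kernel is closed under limits in
    that norm. *)
Lemma functional_limit C F : admissible F ->
  (forall N, exists G, [/\ admissible G, I G = 0 &
     forall v, `|F v - G v| <= C / N.+1%:R * expR (rho * `|v|)]) ->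
  I F = 0.
Proof.
move=> aF hG; apply/eqP; rewrite -normr_le0; apply/ler_addgt0Pl => e e0.
(* This choice gives C M / e < N + 1, so the error C M / (N + 1) is below e. *)
rewrite addr0; pose N := Num.truncn (C * M / e).
have [G [aG G0 FG]] := hG N.
have -> : I F = I (fun v => -1 * G v + F v).
  by rewrite I_linear// G0 mulr0 add0r.
have dFG : dominated (C / N.+1%:R) (fun v => -1 * G v + F v).
  split=> [|v]; first by have [? []] := admissible_linear (-1) aG aF.
  by rewrite mulN1r addrC; exact: FG.
apply: le_trans (I_bound dFG) _.
rewrite mulrAC ler_pdivrMr// -ler_pdivrMl// [leLHS]mulrC.
by apply: ltW; exact: truncnS_gt.
Qed.

Lemma admissible_expR s : `|s| <= rho -> admissible (fun v => expR (s * v)).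
Proof.
move=> sr; exists 1; split=> [|v].
  apply: continuous_fun_comp => [|v]; first exact: continuous_expR.
  by have := @continuous_affine R s 0 v; under [fun v => _ + 0]funext do rewrite addr0.
rewrite mul1r ger0_norm ?expR_ge0// ler_expR (le_trans (ler_norm _))// normrM.
by rewrite ler_wpM2r.
Qed.

Lemma dominated_monomial_cos k (l th : R) :
  dominated (k`!%:R / rho ^+ k) (fun v => v ^+ k * cos (l * v + th)).
Proof.
split=> [|v].
  apply: continuous_fun_mul; first by apply: continuous_fun_exp => v; exact: cvg_id.
  apply: continuous_fun_comp; [exact: continuous_cos|exact: continuous_affine].
rewrite normrM normrX -[leRHS]mulr1; apply: ler_pM => //.
- exact: exprn_le_expR.
- exact: cos_max.
Qed.

Lemma admissible_monomial k : admissible (fun v => v ^+ k).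
Proof.
exists (k`!%:R / rho ^+ k).
rewrite (_ : (fun _ => _) = fun v => v ^+ k * cos (0 * v + 0)).
  exact: dominated_monomial_cos.
by apply/funext => v; rewrite mul0r addr0 cos0 mulr1.
Qed.

(* The Taylor remainder of e^(a v) at order k + 1, divided by a^k / k!, tends to
   0 with a in the weighted norm. *)
Lemma functional_moment k : I (fun v => v ^+ k) = 0.
Proof.
(* Strong induction: the lower terms of the Taylor polynomial are moments already known to
   vanish. *)
have [n] := ubnP k; elim: n k => // n IH k kn.
(* The rate rho is split in two: one half dominates e^(a |v|), as a <= a0, the other the power
   |v|^(k + 1). *)
pose a0 := rho / 2; have a00 : 0 < a0 by rewrite divr_gt0.
pose C := a0 * (k.+1`!%:R / a0 ^+ k.+1).
apply: (@functional_limit C) => [|N]; first exact: admissible_monomial.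
pose a := a0 / N.+1%:R.
have a_gt0 : 0 < a by rewrite divr_gt0.
have a_le : a <= a0 by rewrite ler_piMr ?(ltW a00)// invf_le1 ?ltr0n// ler1n.
have a_rho : `|a| <= rho.
  rewrite gtr0_norm// (le_trans a_le)// ler_piMr ?(ltW rho_gt0)//.
  by rewrite invf_le1 ?ltr0n// ler1n.
have [aS S0] : admissible (fun v => \sum_(j < k) (a ^+ j / j`!%:R) * v ^+ j) /\
    I (fun v => \sum_(j < k) (a ^+ j / j`!%:R) * v ^+ j) = 0.
  apply: (@functional_comb k (fun j => a ^+ j / j`!%:R) (fun j v => v ^+ j)) => j jk.
  by split; [exact: admissible_monomial|apply: IH; exact: leq_trans jk _].
have aE := admissible_expR a_rho.
pose H v := -1 * (\sum_(j < k) (a ^+ j / j`!%:R) * v ^+ j) + expR (a * v).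
have aH : admissible H by exact: admissible_linear.
have H0 : I H = 0 by rewrite /H I_linear// S0 I_expR// mulr0 addr0.
pose b := k`!%:R / a ^+ k.
have [z1 z2] := functional0.
exists (fun v => b * H v + 0); split.
- exact: admissible_linear.
- by rewrite I_linear// H0 z2 mulr0 addr0.
move=> v; rewrite addr0.
have fk : 0 < k`!%:R :> R by rewrite ltr0n fact_gt0.
have b0 : 0 < b by rewrite divr_gt0// exprn_gt0.
have -> : v ^+ k - b * H v =
   - b * (expR (a * v) - \sum_(j < k.+1) (a * v) ^+ j / j`!%:R).
  rewrite big_ord_recr /= /H /b (exprMn k a v).
  under [in RHS]eq_bigr do rewrite (exprMn _ a v) mulrAC.
  set S := \sum_(j < k) _; field.
  by rewrite !gt_eqF ?exprn_gt0.
rewrite normrM normrN (gtr0_norm b0).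
apply: le_trans (ler_wpM2l (ltW b0) (expR_taylor _ _)) _.
rewrite normrM (gtr0_norm a_gt0) exprMn.
have he : expR (a * `|v|) <= expR (a0 * `|v|) by rewrite ler_expR ler_wpM2r.
have hv := exprn_le_expR v k.+1 a00.
have hr : expR (rho * `|v|) = expR (a0 * `|v|) * expR (a0 * `|v|).
  by rewrite -expRD -mulrDl -splitr.
rewrite hr.
have -> : b * (expR (a * `|v|) * (a ^+ k.+1 * `|v| ^+ k.+1 / k.+1`!%:R)) =
   (a / k.+1%:R) * (expR (a * `|v|) * `|v| ^+ k.+1).
  rewrite /b factS natrM exprS; field.
  by rewrite nat1r !gt_eqF ?exprn_gt0.
have -> : C / N.+1%:R * (expR (a0 * `|v|) * expR (a0 * `|v|)) =
   a * (expR (a0 * `|v|) * (k.+1`!%:R / a0 ^+ k.+1 * expR (a0 * `|v|))).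
  by rewrite /a /C; ring.
apply: ler_pM.
- by rewrite mulr_ge0 ?invr_ge0// ltW.
- by rewrite mulr_ge0 ?expR_ge0 ?exprn_ge0.
- by rewrite ler_piMr ?(ltW a_gt0)// invf_le1 ?ltr0n// ler1n.
- by apply: ler_pM; rewrite ?expR_ge0 ?exprn_ge0.
Qed.

Let cos_vanish l := forall k th, I (fun v => v ^+ k * cos (l * v + th)) = 0.

(* The increment d is small enough for the Taylor series of cos at l v + th to
   converge in the weighted norm. *)
Lemma functional_cos_step l d : `|d| <= rho / 4 -> cos_vanish l -> cos_vanish (l + d).
Proof.
move=> dr hl k th.
(* Again one half of the rate absorbs |v|^k and the other the Taylor remainder of the cosine. *)
pose a := rho / 2; have a0 : 0 < a by rewrite divr_gt0.
apply: (@functional_limit (k`!%:R / a ^+ k)) => [|N].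
  by exists (k`!%:R / rho ^+ k); exact: dominated_monomial_cos.
pose F j v := v ^+ (k + j) * cos (l * v + (th + j%:R * (pi / 2))).
have hF j : (j < N)%N -> admissible (F j) /\ I (F j) = 0.
  by move=> _; split; [eexists; exact: dominated_monomial_cos|exact: hl].
have [aS S0] := functional_comb (fun j => d ^+ j / j`!%:R) hF.
exists (fun v => \sum_(j < N) d ^+ j / j`!%:R * F j v); split=> // v.
have -> : v ^+ k * cos ((l + d) * v + th) - \sum_(j < N) d ^+ j / j`!%:R * F j v =
    v ^+ k * (cos ((l * v + th) + d * v) -
      \sum_(j < N) (d * v) ^+ j / j`!%:R * cos ((l * v + th) + j%:R * (pi / 2))).
  rewrite mulrBr mulr_sumr; congr (_ * cos _ - _); first by ring.
  by apply: eq_bigr => j _; rewrite /F exprD exprMn addrA; ring.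
rewrite normrM normrX.
have hr : expR (rho * `|v|) = expR (a * `|v|) * expR (a * `|v|).
  by rewrite -expRD -mulrDl -splitr.
have -> : k`!%:R / a ^+ k / N.+1%:R * expR (rho * `|v|) =
    k`!%:R / a ^+ k * expR (a * `|v|) * (expR (a * `|v|) / N.+1%:R).
  by rewrite hr; ring.
apply: ler_pM; rewrite ?exprn_ge0//; first exact: exprn_le_expR.
apply: le_trans (cos_taylor _ _ _) _; rewrite normrM exprMn -mulrA.
have fN : 0 < N`!%:R :> R by rewrite ltr0n fact_gt0.
have hv : `|v| ^+ N / N`!%:R <= a ^- N * expR (a * `|v|).
  rewrite ler_pdivrMr// (le_trans (exprn_le_expR v N a0))//.
  by rewrite [leRHS]mulrC mulrA.
apply: le_trans (ler_wpM2l (exprn_ge0 N (normr_ge0 d)) hv) _.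
rewrite mulrA mulrC ler_wpM2l ?expR_ge0// -exprVn -exprMn.
(* As |d| <= rho / 4 = a / 2, the ratio |d| / a is at most 1/2; then N + 1 <= 2^N gives the rate
   asked by [functional_limit]. *)
apply: (@le_trans _ _ (2^-1 ^+ N)).
  apply: lerXn2r; rewrite ?nnegrE ?mulr_ge0 ?invr_ge0 ?(ltW a0)//.
  by rewrite ler_pdivrMr// /a; lra.
rewrite exprVn lef_pV2 ?posrE ?exprn_gt0// -natrX ler_nat.
exact: ltn_expl.
Qed.

(** At frequency 0 the cosine is a constant and the moments vanish; l is then reached in [m] equal
    steps of size at most rho / 4. *)
Lemma functional_cos l k th : I (fun v => v ^+ k * cos (l * v + th)) = 0.
Proof.
have r4 : 0 < rho / 4 by rewrite divr_gt0.
pose m := (Num.truncn (`|l| / (rho / 4))).+1.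
have lm : `|l / m%:R| <= rho / 4.
  rewrite normrM normfV normr_nat ler_pdivrMr// mulrC -ler_pdivrMr//.
  by apply: ltW; exact: truncnS_gt.
suff main j : cos_vanish (j%:R * (l / m%:R)).
  by have := main m k th; rewrite mulrC divfK// pnatr_eq0.
elim: j => [k' th'|j IH].
  have [z1 z2] := functional0.
  have := @I_linear (cos th') _ _ (admissible_monomial k') z1.
  rewrite functional_moment z2 mulr0 addr0 => <-.
  by congr I; apply/funext => v; rewrite !mul0r add0r addr0 mulrC.
by rewrite -natr1 mulrDl mul1r; exact: functional_cos_step.
Qed.

(** The product formula trades one power of the cosine for the two frequencies l + b and l - b,
    hence the induction over all l and th. *)
Lemma functional_cos_expn (b u0 : R) N l th :
  I (fun v => cos (b * (v - u0)) ^+ N * cos (l * v + th)) = 0.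
Proof.
have adm K l' th' : admissible (fun v => cos (b * (v - u0)) ^+ K * cos (l' * v + th')).
  exists 1; apply: dominated_bounded => [|v].
    apply: continuous_fun_mul; last first.
      by apply: continuous_fun_comp; [exact: continuous_cos|exact: continuous_affine].
    apply: continuous_fun_exp; apply: continuous_fun_comp; first exact: continuous_cos.
    rewrite (_ : (fun v => _) = fun v => b * v + - (b * u0)).
      exact: continuous_affine.
    by apply/funext => v; ring.
  by rewrite normrM normrX mulr_ile1 ?exprn_ge0 ?exprn_ile1 ?cos_max.
elim: N l th => [|N IH] l th.
  rewrite -[RHS](functional_cos l 0 th).
  by congr I; apply/funext => v; rewrite !expr0.
have [z1 z2] := functional0.
have a1 := adm N (l + b) (th - b * u0); have a2 := adm N (l - b) (th + b * u0).
transitivity (I (fun v => 2^-1 *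
     (cos (b * (v - u0)) ^+ N * cos ((l + b) * v + (th - b * u0))) +
   (2^-1 * (cos (b * (v - u0)) ^+ N * cos ((l - b) * v + (th + b * u0))) + 0))).
  congr I; apply/funext => v; rewrite exprSr.
  have -> : (l + b) * v + (th - b * u0) = (l * v + th) + b * (v - u0) by ring.
  have -> : (l - b) * v + (th + b * u0) = (l * v + th) - b * (v - u0) by ring.
  by set w := l * v + th; set z := b * (v - u0); rewrite (cosD w z) (cosB w z); field.
rewrite I_linear ?I_linear ?IH ?z2 ?mulr0 ?addr0//.
exact: admissible_linear.
Qed.

Lemma dominated_gauss (s u0 : R) :
  dominated 1 (fun v => expR (- ((s * (v - u0)) ^+ 2 / 2))).
Proof.
apply: dominated_bounded => [|v].
  apply: continuous_fun_comp; first exact: continuous_expR.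
  rewrite (_ : (fun v => _) = fun v => (- 2^-1) * (s * v + - (s * u0)) ^+ 2).
    apply: continuous_fun_mul; first exact: continuous_fun_cst.
    by apply: continuous_fun_exp; exact: continuous_affine.
  by apply/funext => v; field.
by rewrite ger0_norm ?expR_ge0// expR_le1 oppr_le0 divr_ge0// sqr_ge0.
Qed.

(* cos (x / m)^(m^2) tends to e^(- x^2 / 2), with error O ((|x|^3 + x^4) / m)
   uniformly in x, hence in the weighted norm. *)
Lemma functional_gauss (s u0 : R) : 0 < s ->
  I (fun v => expR (- ((s * (v - u0)) ^+ 2 / 2))) = 0.
Proof.
move=> s0.
(* With this rate, a |x| = rho |v - u0| <= rho |u0| + rho |v| for x = s (v - u0), which is the
   weight up to a constant. *)
pose a := rho / s; have a0 : 0 < a by rewrite divr_gt0.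
pose C := (3`!%:R / a ^+ 3 + 4`!%:R / a ^+ 4) * expR (rho * `|u0|).
have aff b : continuous (fun v => b * (v - u0)).
  rewrite (_ : (fun v => _) = fun v => b * v + - (b * u0)).
    exact: continuous_affine.
  by apply/funext => v; ring.
apply: (@functional_limit C) => [|N].
  by exists 1; exact: dominated_gauss.
pose m : R := N.+1%:R; have m0 : 0 < m by rewrite ltr0n.
(* The last factor is 1; it gives [G] the form of [functional_cos_expn]. *)
pose G v := cos (s / m * (v - u0)) ^+ (N.+1 ^ 2) * cos (0 * v + 0).
exists G; split.
- exists 1; apply: dominated_bounded => [|v].
    apply: continuous_fun_mul; last first.
      by apply: continuous_fun_comp; [exact: continuous_cos|exact: continuous_affine].
    by apply: continuous_fun_exp; apply: continuous_fun_comp; first exact: continuous_cos.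
  by rewrite normrM normrX mulr_ile1 ?exprn_ge0 ?exprn_ile1 ?cos_max.
- exact: functional_cos_expn.
move=> v; rewrite /G mul0r addr0 cos0 mulr1.
set x := s * (v - u0).
have -> : s / m * (v - u0) = x / m by rewrite /x; ring.
(* The Gaussian is itself an m^2-th power, so only the bases at x / m have to be compared, at the
   cost of a factor m^2. *)
have -> : expR (- (x ^+ 2 / 2)) = expR (- ((x / m) ^+ 2 / 2)) ^+ (N.+1 ^ 2).
  rewrite -expRM_natl natrX -/m; congr expR; field.
  by rewrite gt_eqF.
rewrite distrC; apply: le_trans (normr_subX_le _ _ _) _.
- exact: cos_max.
- by rewrite ger0_norm ?expR_ge0// expR_le1 oppr_le0 divr_ge0// sqr_ge0.
apply: le_trans (ler_wpM2l (ler0n _ _) (cos_expR_bound _)) _.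
have ex : expR (a * `|x|) <= expR (rho * `|u0|) * expR (rho * `|v|).
  rewrite -expRD ler_expR /x normrM (gtr0_norm s0) mulrA divfK ?gt_eqF//.
  by rewrite -mulrDr ler_wpM2l ?(ltW rho_gt0)// [leRHS]addrC; exact: ler_normB.
have hx k : `|x| ^+ k <= k`!%:R / a ^+ k * (expR (rho * `|u0|) * expR (rho * `|v|)).
  apply: le_trans (exprn_le_expR x k a0) _.
  by rewrite ler_wpM2l// divr_ge0// exprn_ge0// ltW.
rewrite natrX -/m normrM normfV (gtr0_norm m0).
have -> : m ^+ 2 * ((`|x| / m) ^+ 3 + (`|x| / m) ^+ 4) =
   (`|x| ^+ 3 + m^-1 * `|x| ^+ 4) / m by field; rewrite gt_eqF.
rewrite /C mulrAC ler_wpM2r ?invr_ge0 ?(ltW m0)//.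
rewrite -mulrA mulrDl lerD//.
apply: le_trans (hx 4).
by rewrite ler_piMl ?exprn_ge0// invf_le1// ler1n.
Qed.

End ExpFunctional.

(** * Integration over the open unit interval *)

Section UnitInterval.
Context {R : realType}.
Local Notation mu := (@lebesgue_measure R).
Local Notation D := (`]0%R, 1%R[%classic : set R).
Implicit Types (f F u psi : R -> R).

Lemma measurable_fun_unit f : {in `]0, 1[, continuous f} -> measurable_fun D f.
Proof.
move=> cf; apply: open_continuous_measurable_fun; first exact: interval_open.
exact/in_continuous_mksetP.
Qed.

Lemma is_derive_continuous f (df x : R) : is_derive x 1 f df -> {for x, continuous f}.
Proof. by move=> fx; apply/differentiable_continuous/derivable1_diffP; case: fx. Qed.

(** On compact subintervals the integral is a difference of two values of [F], hence at most 2 B;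
    monotone convergence extends the bound to ]0, 1[. *)
Lemma ge0_bounded_primitive_integrable (F f : R -> R) (B : R) :
  (forall t : R, 0 < t < 1 -> is_derive t 1 F (f t)) ->
  {in `]0, 1[, continuous f} -> (forall t : R, 0 < t < 1 -> 0 <= f t) ->
  (forall t : R, 0 < t < 1 -> `|F t| <= B) ->
  mu.-integrable D (EFin \o f).
Proof.
move=> dF cf f0 FB.
(* The shift by 3 keeps the endpoints in order: 1 / (i + 3) <= 1/3 < 1/2. *)
pose K (i : nat) := (`[i.+3%:R^-1, 1 - i.+3%:R^-1]%classic : set R).
have KD i : K i `<=` D.
  move=> t; rewrite /K /= !in_itv/= => /andP[t1 t2]; apply/andP; split.
    by apply: lt_le_trans t1; rewrite invr_gt0.
  by apply: le_lt_trans t2 _; rewrite ltrBlDr ltrDl invr_gt0.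
have UK : \bigcup_i K i = D.
  apply/seteqP; split => [t [i _]|t]; first exact: KD.
  rewrite /= in_itv/= => /andP[t0 t1].
  pose e := Num.min t (1 - t); have e0 : 0 < e by rewrite lt_min t0 subr_gt0.
  have ie : (Num.truncn e^-1).+3%:R^-1 <= e.
    rewrite -[leRHS]invrK lef_pV2 ?posrE ?invr_gt0//.
    by apply: le_trans (ltW (truncnS_gt _)) _; rewrite ler_nat !ltnS leqW.
  exists (Num.truncn e^-1) => //; rewrite /K /= in_itv/=; apply/andP; split.
    by apply: le_trans ie _; rewrite ge_min lexx.
  by rewrite lerBrDr -lerBrDl; apply: le_trans ie _; rewrite ge_min lexx orbT.
have mf : measurable_fun D f := measurable_fun_unit cf.
have ndK : nondecreasing_seq K.
  move=> i j ij; rewrite subsetEset => t; rewrite /K /= !in_itv/= => /andP[t1 t2].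
  have ij' : (j.+3%:R^-1 : R) <= i.+3%:R^-1 by rewrite lef_pV2 ?posrE// ler_nat.
  by rewrite (le_trans ij' t1)/= (le_trans t2)// lerB.
apply/integrableP; split; first exact/measurable_EFinP.
have -> : (\int[mu]_(x in D) `|(EFin \o f) x| = \int[mu]_(x in D) (f x)%:E)%E.
  apply: eq_integral => x; rewrite inE/= in_itv/= => x01.
  by rewrite ger0_norm// f0.
have bK i : (\int[mu]_(x in K i) (f x)%:E <= (B + B)%:E)%E.
  have i3 : 0 < i.+3%:R^-1 :> R by rewrite invr_gt0.
  have i3' : (i.+3%:R^-1 : R) <= 3^-1 by rewrite lef_pV2 ?posrE// ler_nat.
  have := KD i; rewrite /K; move: (i.+3%:R^-1 : R) i3 i3' => e e0 e3 KiD.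
  have ab : e < 1 - e by lra.
  have in01 x : e <= x <= 1 - e -> 0 < x < 1 by lra.
  rewrite (@continuous_FTC2 _ f F)//.
  - rewrite -EFinB lee_fin; apply: lerD.
      by apply: le_trans (ler_norm _) (FB _ _); apply: in01; lra.
    by rewrite (le_trans (ler_norm _))// normrN; apply: FB; apply: in01; lra.
  - apply: continuous_in_subspaceT => x; rewrite inE => /KiD.
    exact: cf.
  - split.
    + move=> x; rewrite in_itv/= => x01.
      by have [] : is_derive x 1 F (f x) by apply: dF; apply: in01; lra.
    + by apply/cvg_at_right_filter/is_derive_continuous/dF/in01; lra.
    + by apply/cvg_at_left_filter/is_derive_continuous/dF/in01; lra.
  - move=> x; rewrite in_itv/= => x01; rewrite derive1E.
    by have := @derive_val _ _ _ _ _ _ _ (dF x _); apply; apply: in01; lra.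
have cvgK : (\int[mu]_(x in K i) (f x)%:E @[i --> \oo] -->
             \int[mu]_(x in D) (f x)%:E)%E.
  rewrite -UK; apply: ge0_nondecreasing_set_cvg_integral => //.
  - by move=> i; exact: measurable_itv.
  - by move=> i; apply/measurable_EFinP; apply: measurable_funS mf => //; exact: KD.
  - by move=> i x /KD; rewrite /= in_itv/= => x01; rewrite lee_fin f0.
rewrite -(cvg_lim _ cvgK)//.
apply: (@le_lt_trans _ _ (B + B)%:E); last exact: ltry.
apply: lime_le; first by apply/cvg_ex; eexists; exact: cvgK.
by near=> i; exact: bK.
Unshelve. all: by end_near. Qed.

(** * The Beta kernel and its integrability *)

Definition beta_kernel (a b t : R) := t `^ (a - 1) * (1 - t) `^ (b - 1).

Lemma is_derive_powR_onem (b t : R) : 0 < t < 1 ->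
  is_derive t 1 (fun t => (1 - t) `^ b) (- (b * (1 - t) `^ (b - 1))).
Proof.
move=> t01; have t1 : 0 < 1 - t by lra.
rewrite (_ : (fun _ => _) = (@powR R ^~ b) \o (cst 1 - id)); last exact/funext.
have ? : is_derive ((cst 1 - id) t) 1 (@powR R ^~ b) (b * (1 - t) `^ (b - 1)).
  exact: is_derive1_powR.
by apply: is_derive_eq; rewrite sub0r mulrN1.
Qed.

Lemma continuous_beta_kernel (a b : R) : {in `]0, 1[, continuous (beta_kernel a b)}.
Proof.
move=> t; rewrite in_itv/= => t01; have /andP[t0 _] := t01.
apply: cvgM.
  exact: is_derive_continuous (is_derive1_powR (a - 1) t0).
exact: is_derive_continuous (is_derive_powR_onem (b - 1) t01).
Qed.

Lemma beta_kernel_gt0 (a b t : R) : 0 < t < 1 -> 0 < beta_kernel a b t.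
Proof. by move=> t01; rewrite mulr_gt0// powR_gt0//; lra. Qed.

Lemma powR_le1 (c x : R) : 0 < c -> 0 < x < 1 -> x `^ c <= 1.
Proof.
move=> c0 /andP[x0 x1]; rewrite -(powRr0 x); apply: ger_powR; last exact: ltW.
by rewrite x0 ltW.
Qed.

(* As t + (1 - t) = 1, the kernel is at most t^(a - 1) + (1 - t)^(b - 1), which
   has the bounded primitive t^a / a - (1 - t)^b / b. *)
Lemma beta_kernel_integrable (a b : R) : 0 < a -> 0 < b ->
  mu.-integrable D (EFin \o beta_kernel a b).
Proof.
move=> a0 b0.
pose f t : R := t `^ (a - 1) + (1 - t) `^ (b - 1).
have cf : {in `]0, 1[, continuous f}.
  move=> t; rewrite in_itv/= => t01; have /andP[t0 _] := t01.
  apply: cvgD.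
    exact: is_derive_continuous (is_derive1_powR (a - 1) t0).
  exact: is_derive_continuous (is_derive_powR_onem (b - 1) t01).
have intf : mu.-integrable D (EFin \o f).
  apply: (@ge0_bounded_primitive_integrable
    (fun t => a^-1 * t `^ a - b^-1 * (1 - t) `^ b) _ (a^-1 + b^-1)) => //.
  - move=> t t01; have /andP[t0 _] := t01.
    have h1 := is_derive1_powR a t0; have h2 := is_derive_powR_onem b t01.
    rewrite (_ : (fun _ => _) =
      a^-1 \*: (@powR R ^~ a) - b^-1 \*: (fun t => (1 - t) `^ b)) //.
    apply: is_derive_eq; rewrite /f /GRing.scale /=; field.
    by rewrite !gt_eqF.
  - by move=> t _; rewrite addr_ge0// powR_ge0.
  - move=> t t01; apply: le_trans (ler_normB _ _) _.
    have le1 (c x : R) : 0 < c -> 0 < x < 1 -> `|c^-1 * x `^ c| <= c^-1.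
      move=> c0 /andP[x0 x1]; rewrite ger0_norm ?mulr_ge0 ?invr_ge0 ?powR_ge0 ?(ltW c0)//.
      by rewrite ler_piMr ?invr_ge0 ?(ltW c0)// powR_le1// x0.
    by apply: lerD; apply: le1 => //; lra.
apply: le_integrable intf => //.
  apply/measurable_EFinP; apply: measurable_fun_unit.
  exact: continuous_beta_kernel.
move=> t; rewrite /= in_itv/= => t01; rewrite lee_fin.
have /andP[t0 t1] := t01.
rewrite !ger0_norm ?addr_ge0 ?powR_ge0 ?(ltW (beta_kernel_gt0 _ _ _))//.

have le1 (c x : R) : 0 < c -> 0 < x < 1 -> x * x `^ (c - 1) <= 1.
  by move=> c0 x01; rewrite mulr_powRB1 ?powR_le1//; lra.
have := le1 a t a0 t01; have := le1 b (1 - t) b0.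
rewrite /beta_kernel /f; set p := t `^ _; set q := (1 - t) `^ _ => hq hp.
have {}hq : (1 - t) * q <= 1 by apply: hq; lra.
(* Since t p <= 1 and (1 - t) q <= 1, the first summand is at most p and the second at most q. *)
have -> : p * q = p * ((1 - t) * q) + (t * p) * q by ring.
by apply: lerD; [rewrite ler_piMr ?powR_ge0|rewrite ler_piMl ?powR_ge0].
Qed.

(** On ]0, 1[ the function [f] dominates [m] times the indicator of ]a, b[. *)
Lemma Rintegral_ge_cst_sub f (m a b : R) : 0 <= a -> a < b -> b <= 1 ->
  mu.-integrable D (EFin \o f) -> (forall t : R, 0 < t < 1 -> 0 <= f t) ->
  (forall t, a < t < b -> m <= f t) ->
  m * (b - a) <= \int[mu]_(t in D) f t.
Proof.
move=> a0 ab b1 intf f0 fm.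
pose J := (`]a, b[%classic : set R).
have JD : D `&` J = J.
  apply/setIidPr => t; rewrite /J /= !in_itv/= => /andP[at' tb].
  by rewrite (le_lt_trans a0 at') (lt_le_trans tb b1).
have muJ : mu J = (b - a)%:E by rewrite /J lebesgue_measure_itv/= lte_fin ab.
have <- : \int[mu]_(t in D) ((cst m) \_ J) t = m * (b - a).
    have -> : b - a = fine (mu J) by rewrite muJ.
  by rewrite -Rintegral_mkcondr JD Rintegral_cst//; exact: measurable_itv.
apply: le_Rintegral => //.
- rewrite -restrict_EFin; apply/integrable_restrict; [exact: measurable_itv..|].
  rewrite JD; apply: measurable_bounded_integrable => //.
  + exact: measurable_itv.
  + by rewrite [X in (X < _)%E]muJ ltry.
  + by exists `|m|; split => // x mx y _ /=; exact: ltW.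
- move=> t; rewrite /= in_itv/= => t01.
  rewrite patchE; case: ifPn => [|_]; last exact: f0.
  by rewrite inE /J /= in_itv/= => /fm.
Qed.

End UnitInterval.

(** * Injectivity of the Laplace transform in the variable [u] *)

Section LaplaceInjective.
Context {R : realType} (rho : R) (u psi : R -> R).
Local Notation mu := (@lebesgue_measure R).
Local Notation D := (`]0%R, 1%R[%classic : set R).
Context (rho_gt0 : 0 < rho)
  (u_continuous : {in `]0, 1[, continuous u})
  (u_increasing : {in `]0, 1[ &, {homo u : x y / x < y}})
  (psi_continuous : {in `]0, 1[, continuous psi})
  (psi_integrable :
     mu.-integrable D (EFin \o (fun t => expR (rho * `|u t|) * psi t)))
  (laplace0 : forall s : R, `|s| <= rho ->
     \int[mu]_(t in D) (expR (s * u t) * psi t) = 0).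

(** [I] and [M] instantiate the abstract functional and its bound; [M] is the L^1 norm of [psi]
    weighted by e^(rho |u|). *)
Let I (F : R -> R) : R := \int[mu]_(t in D) (F (u t) * psi t).
Let M : R := \int[mu]_(t in D) `|expR (rho * `|u t|) * psi t|.

Let dominated_integrable C F : dominated rho C F ->
  mu.-integrable D (EFin \o (fun t => F (u t) * psi t)).
Proof.
move=> [cF bF].
have intC : mu.-integrable D (EFin \o (fun t => C * (expR (rho * `|u t|) * psi t))).
  exact: (integrableZl _ C psi_integrable).
apply: le_integrable intC => //.
  apply/measurable_EFinP; apply: measurable_fun_unit => t t01.
  apply: cvgM; last exact: psi_continuous.
  by apply: continuous_comp; [exact: u_continuous|exact: cF].
move=> t _; rewrite lee_fin /= !normrM mulrA ler_wpM2r//.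
apply: le_trans (bF (u t)) _; rewrite (ger0_norm (expR_ge0 _)).
by rewrite ler_wpM2r ?expR_ge0// ler_norm.
Qed.

Let I_linear a F G : admissible rho F -> admissible rho G ->
  I (fun v => a * F v + G v) = a * I F + I G.
Proof.
move=> [C dF] [C' dG]; rewrite /I.
have iF := dominated_integrable dF; have iG := dominated_integrable dG.
have iaF : mu.-integrable D (EFin \o (fun t => a * (F (u t) * psi t))).
  exact: (integrableZl _ a iF).
under eq_Rintegral do rewrite mulrDl -mulrA.
by rewrite RintegralD// RintegralZl.
Qed.

Let I_bound C F : dominated rho C F -> `|I F| <= C * M.
Proof.
move=> dF; have iF := dominated_integrable dF.
apply: le_trans (le_normr_Rintegral _ iF) _ => //.
have iM : mu.-integrable D (EFin \o (fun t => `|expR (rho * `|u t|) * psi t|)).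
  exact: (integrable_abse psi_integrable).
rewrite /M -RintegralZl//; apply: le_Rintegral => //.
- exact: (integrable_abse iF).
- exact: (integrableZl _ C iM).
move=> t _; rewrite !normrM mulrA ler_wpM2r// (ger0_norm (expR_ge0 _)).
by case: dF => _; exact.
Qed.

Let I_expR s : `|s| <= rho -> I (fun v => expR (s * v)) = 0.
Proof. exact: laplace0. Qed.

(** Were psi t0 positive, a Gaussian centred at u t0 would collect near t0 a positive mass that, for
    large s, the rest of the integral could not cancel. The opposite sign will come from exchanging
    the two functions of the theorem. *)
Lemma laplace_injective_le0 t0 : 0 < t0 < 1 -> psi t0 <= 0.
Proof.
move=> t001; rewrite leNgt; apply/negP => psi0.
have t0D : t0 \in `]0, 1[ by rewrite in_itv.
pose c := psi t0 / 2; have c0 : 0 < c by rewrite divr_gt0.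
have [e e0 he] : exists2 e : R, 0 < e & forall t, `|t0 - t| < e -> 0 < t < 1 /\ c < psi t.
  have h1 : \forall t \near t0, c < psi t.
    apply: (cvgr_gt _ (psi_continuous t0D)).
    by rewrite ltr_pdivrMr// ltr_pMr// ltr1n.
  have h2 : \forall t \near t0, 0 < t < 1.
    by have := near_in_itvoo t0D; apply: filterS => t; rewrite in_itv.
  have /nbhs_ballP[e /= e0 be] : \forall t \near t0, 0 < t < 1 /\ c < psi t.
    by near=> t; split; near: t.
  by exists e => // t te; apply: be; rewrite /ball/=.
pose a := t0 - e / 2; pose b := t0 + e / 2.
have e2 : 0 < e / 2 by rewrite divr_gt0.
have ae : `|t0 - a| < e by rewrite /a ltr_norml; lra.
have be : `|t0 - b| < e by rewrite /b ltr_norml; lra.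
have [a01 _] := he _ ae; have [b01 _] := he _ be.
(* As [u] is increasing, |u t - u t0| < d forces t between [a] and [b], where psi > c. *)
pose d := Num.min (u b - u t0) (u t0 - u a).
have d0 : 0 < d.
  rewrite lt_min !subr_gt0; apply/andP; split; apply: u_increasing => //.
  - by rewrite /b; lra.
  - by rewrite /a; lra.
have hd t : 0 < t < 1 -> `|u t - u t0| < d -> c < psi t.
  move=> t01; rewrite /d lt_min ltr_norml ltr_norml => /andP[/andP[_ h1] /andP[h2 _]].
  apply: (he _ _).2; rewrite ltr_norml; apply/andP; split.
  - rewrite ltNge; apply/negP => h; suff : u b < u t by lra.
    by apply: u_increasing; rewrite ?in_itv//= /b; lra.
  - rewrite ltNge; apply/negP => h; suff : u t < u a by lra.
    by apply: u_increasing; rewrite ?in_itv//= /a; lra.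
(* Within e' of t0 the value of [u] moves by less than d / 2, which bounds the Gaussian there from
   below. *)
have [e' e'0 he'] : exists2 e' : R, 0 < e' &
    forall t, `|t0 - t| < e' -> 0 < t < 1 /\ `|u t - u t0| < d / 2.
  have h1 : \forall t \near t0, `|u t0 - u t| < d / 2.
    have ct : u x @[x --> t0] --> u t0 := u_continuous t0D.
    have d2 : 0 < d / 2 by rewrite divr_gt0.
    by move/cvgrPdist_lt : ct => /(_ _ d2).
  have h2 : \forall t \near t0, 0 < t < 1.
    by have := near_in_itvoo t0D; apply: filterS => t; rewrite in_itv.
  have /nbhs_ballP[e' /= e'0 be'] :
      \forall t \near t0, 0 < t < 1 /\ `|u t - u t0| < d / 2.
    by near=> t; split; [|rewrite distrC]; near: t.
  by exists e' => // t te; apply: be'; rewrite /ball/=.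
pose r := e' / 2; have r0 : 0 < r by rewrite divr_gt0.
have rlo : 0 <= t0 - r.
  by have [] := he' (t0 - r); [rewrite ltr_norml /r; lra|lra].
have rhi : t0 + r <= 1.
  by have [] := he' (t0 + r); [rewrite ltr_norml /r; lra|lra].
have admG s : 0 < s -> dominated rho 1 (fun v => expR (- ((s * (v - u t0)) ^+ 2 / 2))).
  move=> s0; exact: (dominated_gauss rho_gt0).
have d1 : dominated rho 1 (cst 1).
  by apply: dominated_bounded => // [|v]; [exact: continuous_fun_cst|rewrite normr1].
have ipsi : mu.-integrable D (EFin \o (fun t => `|psi t|)).
  have := integrable_abse (dominated_integrable d1).
  by apply: eq_integrable => // t _ /=; rewrite mul1r.
pose N := \int[mu]_(t in D) `|psi t|.
(* Where |u t - u t0| < d, psi is positive; elsewhere the Gaussian is at most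
   its value at distance d. *)
have key s : 0 < s -> c * expR (- ((s * (d / 2)) ^+ 2 / 2)) * (r + r) <=
    expR (- ((s * d) ^+ 2 / 2)) * N.
  move=> s0; set k := expR (- ((s * d) ^+ 2 / 2)).
  set K := expR (- ((s * (d / 2)) ^+ 2 / 2)).
  have iG := dominated_integrable (admG s s0).
  have ik : mu.-integrable D (EFin \o (fun t => k * `|psi t|)).
    exact: (integrableZl _ k ipsi).
  have G0 : I (fun v => expR (- ((s * (v - u t0)) ^+ 2 / 2))) = 0.
    exact: (functional_gauss rho_gt0 I_linear I_bound I_expR).
  (* The Gaussian term integrates to 0, so the integral is only that of k |psi|; this added term
     makes the integrand nonnegative everywhere. *)
  have -> : k * N = \int[mu]_(t in D)
      (expR (- ((s * (u t - u t0)) ^+ 2 / 2)) * psi t + k * `|psi t|).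
    by rewrite RintegralD// RintegralZl// -[LHS]add0r -[in LHS]G0.
  have -> : r + r = (t0 + r) - (t0 - r) by ring.
  have gauss_le x y : 0 <= x -> x <= y ->
      expR (- ((s * y) ^+ 2 / 2)) <= expR (- ((s * x) ^+ 2 / 2)).
    move=> x0 xy; rewrite ler_expR lerN2 ler_pM2r//.
    rewrite ler_sqr ?nnegrE ?mulr_ge0 ?(ltW s0) ?(le_trans x0)//.
    by rewrite ler_wpM2l// ltW.
  have gabs t : expR (- ((s * (u t - u t0)) ^+ 2 / 2)) =
      expR (- ((s * `|u t - u t0|) ^+ 2 / 2)).
    by rewrite !exprMn -normrX (ger0_norm (sqr_ge0 _)).
  have kpsi t : 0 <= k * `|psi t| by rewrite mulr_ge0 ?expR_ge0.
  apply: Rintegral_ge_cst_sub => //; first by lra.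
  - exact: (integrableD _ iG ik).
  - move=> t t01; have [h|h] := ltP `|u t - u t0| d.
      by rewrite addr_ge0// mulr_ge0 ?expR_ge0// (le_trans (ltW c0))// ltW// hd.
    rewrite gabs -lerBlDr sub0r.
    have := gauss_le d `|u t - u t0| (ltW d0) h; rewrite -/k => hk.
    apply: (@le_trans _ _ (- (expR (- ((s * `|u t - u t0|) ^+ 2 / 2)) * `|psi t|))).
      by rewrite lerN2 ler_wpM2r.
    rewrite -mulrN ler_wpM2l ?expR_ge0// lerNl -normrN; exact: ler_norm.
  - move=> t tr; have [t01 ut] : 0 < t < 1 /\ `|u t - u t0| < d / 2.
      by apply: he'; rewrite ltr_norml /r in tr *; lra.
    apply: (@le_trans _ _ (expR (- ((s * (u t - u t0)) ^+ 2 / 2)) * psi t));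
      last by rewrite lerDl.
    rewrite mulrC gabs; apply: ler_pM; rewrite ?expR_ge0 ?(ltW c0)//.
    + by apply: gauss_le => //; exact: ltW.
    + by apply/ltW/hd => //; lra.
have N0 : 0 <= N by apply: Rintegral_ge0.
pose q := N / (c * (r + r)).
have cr : 0 < c * (r + r) by rewrite mulr_gt0// addr_gt0.
have q0 : 0 <= q by rewrite divr_ge0// ltW.
(* Division of [key] by e^(- (s d)^2 / 2) leaves e^(3/8 (s d)^2) <= q, with 3/8 = 1/2 - 1/8. Here s
   d = 3 (q + 1), and e^z >= 1 + z contradicts this. *)
pose s := (q + 1) * (3 / d).
have s0 : 0 < s by rewrite mulr_gt0 ?divr_gt0//; lra.
have sd : s * d = 3 * (q + 1) by rewrite /s; field; rewrite gt_eqF.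
have := key s s0.
have -> : expR (- ((s * (d / 2)) ^+ 2 / 2)) =
    expR (- ((s * d) ^+ 2 / 2)) * expR (3 / 8 * (s * d) ^+ 2).
  by rewrite -expRD; congr expR; field.
set k := expR (- _); set K := expR (3 / 8 * _).
have -> : c * (k * K) * (r + r) = k * (K * (c * (r + r))) by ring.
rewrite ler_pM2l ?expR_gt0// -ler_pdivlMr// -/q.
apply/negP; rewrite -ltNge; apply: lt_le_trans (expR_ge1Dx _).
by rewrite sd; nra.
Unshelve. all: by end_near. Qed.

End LaplaceInjective.

(** * The logit variable and uniqueness for Beta kernels *)

Section BetaKernel.
Context {R : realType}.
Local Notation mu := (@lebesgue_measure R).
Local Notation D := (`]0%R, 1%R[%classic : set R).

Definition logit (t : R) := ln t - ln (1 - t).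

(** As e^(s logit t) = (t / (1 - t))^s, shifting the parameters in opposite directions amounts to a
    Laplace transform in logit t. *)
Lemma expR_logit_beta_kernel (s a b t : R) : 0 < t < 1 ->
  expR (s * logit t) * beta_kernel a b t = beta_kernel (a + s) (b - s) t.
Proof.
move=> t01; have tn0 : t != 0 by rewrite gt_eqF//; lra.
have t1n0 : 1 - t != 0 by rewrite gt_eqF//; lra.
rewrite /beta_kernel /powR (negPf tn0) (negPf t1n0) -!expRD /logit.
by congr expR; ring.
Qed.

Lemma continuous_logit : {in `]0, 1[, continuous logit}.
Proof.
move=> t; rewrite in_itv/= => t01; apply: cvgB.
  by apply: continuous_ln; lra.
apply: continuous_comp; last by apply: continuous_ln; lra.
by apply: cvgB; [exact: cvg_cst|exact: cvg_id].
Qed.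

Lemma logit_increasing : {in `]0, 1[ &, {homo logit : x y / x < y}}.
Proof.
move=> x y; rewrite !in_itv/= => x01 y01 xy.
by rewrite /logit ltrB// ltr_ln ?posrE//; lra.
Qed.

(** The kernel has a positive minimum on [1/4, 3/4]. Positivity allows the normalizing factor to be
    cancelled. *)
Lemma euler_beta_gt0 (a b : R) : 0 < a -> 0 < b -> 0 < euler_beta a b.
Proof.
move=> a0 b0.
have le13 : 1 / 4 <= 3 / 4 :> R by lra.
have ck : {within `[1 / 4, 3 / 4], continuous (beta_kernel a b)}.
  apply: continuous_in_subspaceT => t; rewrite inE/= in_itv/= => h.
  by apply: continuous_beta_kernel; rewrite in_itv/=; lra.
have [c + hc] := EVT_min le13 ck; rewrite in_itv/= => c01.
apply: (@lt_le_trans _ _ (beta_kernel a b c * (3 / 4 - 1 / 4))).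
  by apply: mulr_gt0; [apply: beta_kernel_gt0; lra|lra].
apply: Rintegral_ge_cst_sub; [lra|lra|lra|exact: beta_kernel_integrable| |].
- by move=> t t01; apply/ltW/beta_kernel_gt0.
- by move=> t t01; apply: hc; rewrite in_itv/=; lra.
Qed.

Lemma beta_kernel_bounded_integrable (a b B : R) (h : R -> R) : 0 < a -> 0 < b ->
  {in `]0, 1[, continuous h} -> (forall t, 0 < t < 1 -> `|h t| <= B) ->
  mu.-integrable D (EFin \o (fun t => beta_kernel a b t * h t)).
Proof.
move=> a0 b0 ch hB.
have intB : mu.-integrable D (EFin \o (fun t => B * beta_kernel a b t)).
  exact: (integrableZl _ B (beta_kernel_integrable a0 b0)).
apply: le_integrable intB => //.
  apply/measurable_EFinP; apply: measurable_fun_unit => t t01.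
  by apply: cvgM; [exact: continuous_beta_kernel|exact: ch].
move=> t; rewrite /= in_itv/= => t01; rewrite lee_fin !normrM mulrC ler_wpM2r//.
exact: le_trans (hB _ t01) (ler_norm _).
Qed.

(** The kernel of parameters (c, c) is positive, so [h] has the sign of [psi], to which Laplace
    injectivity applies. *)
Lemma beta_kernel_uniqueness (c rho B : R) (h : R -> R) :
  0 < rho -> rho < c -> {in `]0, 1[, continuous h} ->
  (forall t, 0 < t < 1 -> `|h t| <= B) ->
  (forall s, `|s| <= rho ->
     \int[mu]_(t in D) (beta_kernel (c + s) (c - s) t * h t) = 0) ->
  forall t, 0 < t < 1 -> h t <= 0.
Proof.
move=> rho0 rhoc ch hB h0 t t01.
pose psi t := beta_kernel c c t * h t.
suff : psi t <= 0 by rewrite pmulr_rle0// beta_kernel_gt0.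
apply: (@laplace_injective_le0 _ rho logit psi) => //.
- exact: continuous_logit.
- exact: logit_increasing.
- by move=> x x01; apply: cvgM; [exact: continuous_beta_kernel|exact: ch].
(* The weight e^(rho |logit|) is at most e^(rho logit) + e^(- rho logit), which turns the kernel
   into those of parameters c + rho and c - rho, positive as rho < c. *)
- have i1 : mu.-integrable D (EFin \o (fun t => B * beta_kernel (c + rho) (c - rho) t)).
    have k1 : mu.-integrable D (EFin \o beta_kernel (c + rho) (c - rho)).
      by apply: beta_kernel_integrable; lra.
    exact: (integrableZl _ B k1).
  have i2 : mu.-integrable D (EFin \o (fun t => B * beta_kernel (c - rho) (c + rho) t)).
    have k1 : mu.-integrable D (EFin \o beta_kernel (c - rho) (c + rho)).
      by apply: beta_kernel_integrable; lra.
    exact: (integrableZl _ B k1).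
  have i12 : mu.-integrable D (EFin \o (fun t => B * beta_kernel (c + rho) (c - rho) t +
      B * beta_kernel (c - rho) (c + rho) t)).
    exact: (integrableD _ i1 i2).
  apply: le_integrable i12 => //.
    apply/measurable_EFinP; apply: measurable_fun_unit => x x01.
    apply: cvgM; last by apply: cvgM; [exact: continuous_beta_kernel|exact: ch].
    apply: continuous_comp; last exact: continuous_expR.
    apply: cvgM; first exact: cvg_cst.
    by apply: cvg_norm; exact: continuous_logit.
  move=> x; rewrite /= in_itv/= => x01; rewrite lee_fin /psi mulrA normrM.
  have B0 : 0 <= B := le_trans (normr_ge0 _) (hB _ x01).
  rewrite -mulrDr [leRHS]normrM (ger0_norm B0) [leLHS]mulrC.
  apply: ler_pM => //; first exact: hB.
  have k0 a b : 0 <= beta_kernel a b x := ltW (beta_kernel_gt0 a b x01).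
  rewrite [leRHS]ger0_norm; last by apply: addr_ge0; exact: k0.
  rewrite [leLHS]ger0_norm; last by apply: mulr_ge0; [exact: expR_ge0|exact: k0].
  rewrite -(expR_logit_beta_kernel rho)//.
  have -> : beta_kernel (c - rho) (c + rho) x =
      expR (- rho * logit x) * beta_kernel c c x.
    by rewrite expR_logit_beta_kernel// opprK.
  rewrite -mulrDl ler_wpM2r//.
  have [l0|l0] := leP 0 (logit x); first by rewrite ger0_norm// lerDl expR_ge0.
  by rewrite ltr0_norm// mulrN -mulNr lerDr expR_ge0.
- move=> s hs; rewrite -[RHS](h0 s hs); apply: eq_Rintegral => x.
  by rewrite inE/= in_itv/= => x01; rewrite mulrA expR_logit_beta_kernel.
Qed.

End BetaKernel.

(** * Injectivity of the genuine Beta operator *)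

Lemma continuous_itv_bounded {R : realType} (f : R -> R) :
  {within `[0, 1], continuous f} -> exists B, forall t, t \in `[0, 1] -> `|f t| <= B.
Proof.
move=> cf; have [a _ ha] := EVT_max ler01 cf; have [b _ hb] := EVT_min ler01 cf.
exists (`|f a| + `|f b|) => t t01; rewrite ler_norml.
have := ha t t01; have := hb t t01; have := ler_norm (f a); have := ler_norm (- f b).
have := normr_ge0 (f a); have := normr_ge0 (f b).
by rewrite normrN; lra.
Qed.

(** The endpoints are interpolated by definition; inside, uniqueness for Beta kernels applies to f -
    g. Equality follows by symmetry in [f] and [g]. *)
Lemma genuine_beta_le {R : realType} (n : nat) (f g : R -> R) : (1 <= n)%N ->
  {within `[0, 1], continuous f} -> {within `[0, 1], continuous g} ->
  {in `[0, 1], genuine_beta n f =1 genuine_beta n g} ->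
  {in `[0, 1], forall x, f x <= g x}.
Proof.
move=> n1 cf cg fg x x01.
have n0 : 0 < n%:R :> R by rewrite ltr0n.
have [x0|xn0] := eqVneq x 0.
  by have := fg x x01; rewrite /genuine_beta x0 eqxx => ->.
have [x1|xn1] := eqVneq x 1.
  by have := fg x x01; rewrite /genuine_beta x1 oner_eq0 eqxx => ->.
have {xn0 xn1} x01o : 0 < x < 1.
  by move: x01; rewrite in_itv/= !lt_neqAle xn1 (eq_sym 0) xn0.
have [Bf hBf] := continuous_itv_bounded cf.
have [Bg hBg] := continuous_itv_bounded cg.
have oc (t : R) : 0 < t < 1 -> t \in `[0, 1] by rewrite in_itv/= => /andP[/ltW-> /ltW->].
have [cf' _ _] := (continuous_within_itvP f ltr01).1 cf.
have [cg' _ _] := (continuous_within_itvP g ltr01).1 cg.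
(* Both kernel parameters equal n / 2 at x = 1/2; the range |s| <= n / 4 keeps c + s and c - s
   positive. *)
pose c := n%:R / 2 : R.
rewrite -subr_le0.
apply: (@beta_kernel_uniqueness R c (n%:R / 4) (Bf + Bg) (fun t => f t - g t)) => //.
- by rewrite divr_gt0.
- by rewrite /c; lra.
- by move=> t t01; apply: cvgB; [exact: cf'|exact: cg'].
- move=> t t01; apply: le_trans (ler_normB _ _) _.
  by apply: lerD; [apply: hBf|apply: hBg]; exact: oc.
move=> s; rewrite ler_norml => hs.
have a0 : 0 < c + s by rewrite /c; lra.
have b0 : 0 < c - s by rewrite /c; lra.
have intf : lebesgue_measure.-integrable `]0, 1[
    (EFin \o (fun t => beta_kernel (c + s) (c - s) t * f t)).
  by apply: (@beta_kernel_bounded_integrable _ _ _ Bf) => // t t01; apply: hBf; exact: oc.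
have intg : lebesgue_measure.-integrable `]0, 1[
    (EFin \o (fun t => beta_kernel (c + s) (c - s) t * g t)).
  by apply: (@beta_kernel_bounded_integrable _ _ _ Bg) => // t t01; apply: hBg; exact: oc.
under eq_Rintegral do rewrite mulrBr.
rewrite RintegralB//; apply/eqP; rewrite subr_eq0; apply/eqP.
(* This is 1/2 + s / n, the point whose kernel has parameters c + s and c - s. *)
pose y : R := (c + s) / n%:R.
have ny : n%:R * y = c + s by rewrite /y mulrC divfK// gt_eqF.
have ny' : n%:R * (1 - y) = c - s by rewrite mulrBr ny mulr1 /c; lra.
have y01 : 0 < y < 1.
  apply/andP; split; first by rewrite divr_gt0.
  by rewrite -subr_gt0 -(pmulr_rgt0 _ n0) ny'.
have := fg y (oc _ y01); rewrite /genuine_beta.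
have /andP[y0 y1] := y01.
rewrite (gt_eqF y0) (lt_eqF y1) ny ny' => /mulfI; apply.
by rewrite invr_eq0 gt_eqF// euler_beta_gt0.
Qed.

Theorem theorem3p1 (R : realType) (n : nat) (hn : (1 <= n)%N) (f g : R -> R)
    (hf : {within `[0, 1], continuous f})
    (hg : {within `[0, 1], continuous g}) :
  {in `[0, 1], genuine_beta n f =1 genuine_beta n g} ->
  {in `[0, 1], f =1 g}.
Proof.
move=> fg x x01; apply/eqP; rewrite eq_le; apply/andP; split.
  exact: (genuine_beta_le hn hf hg fg).
by apply: (genuine_beta_le hn hg hf) => // y y01; rewrite fg.
Qed.
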